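(* Let $J\subset\mathbb R$ be an interval, let $\alpha_1,\dots,\alpha_m\colon J\to\mathbb R$ be continuous functions linearly independent on $J$, let $A_1,\dots,A_m$ be pairwise commuting real constant $n\times n$ matrices, let $B_j=A_j^{T}$, and let $f\colon J\to\mathbb R^n$ be continuous. Suppose $\nu=\overset{*}{\nu}+\widetilde\nu\, i$ ($\overset{*}{\nu}=\mathrm{Re}\,\nu$, $\widetilde\nu=\mathrm{Im}\,\nu\neq0$) is a common complex eigenvector of the matrices $B_j$ corresponding to the eigenvalues $\lambda^{j}=\overset{*}{\lambda}{}^{j}+\widetilde\lambda{}^{j} i$ ($\overset{*}{\lambda}{}^{j}=\mathrm{Re}\,\lambda^{j}$, $\widetilde\lambda{}^{j}=\mathrm{Im}\,\lambda^{j}$), $j=1,\dots,m$. Fix $t_0\in J$ and define for $(t,x)\in J\times\mathbb R^n$ $$\gamma_1(t,x)=\Bigl(\overset{*}{\nu}x\cos\int_{t_0}^{t}\sum_{j=1}^{m}\widetilde\lambda{}^{j}\alpha_j(\tau)\,d\tau+\widetilde\nu x\sin\int_{t_0}^{t}\sum_{j=1}^{m}\widetilde\lambda{}^{j}\alpha_j(\tau)\,d\tau\Bigr)\exp\Bigl(-\int_{t_0}^{t}\sum_{j=1}^{m}\overset{*}{\lambda}{}^{j}\alpha_j(\tau)\,d\tau\Bigr),$$ $$\gamma_2(t,x)=\Bigl(\widetilde\nu x\cos\int_{t_0}^{t}\sum_{j=1}^{m}\widetilde\lambda{}^{j}\alpha_j(\tau)\,d\tau-\overset{*}{\nu}x\sin\int_{t_0}^{t}\sum_{j=1}^{m}\widetilde\lambda{}^{j}\alpha_j(\tau)\,d\tau\Bigr)\exp\Bigl(-\int_{t_0}^{t}\sum_{j=1}^{m}\overset{*}{\lambda}{}^{j}\alpha_j(\tau)\,d\tau\Bigr).$$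 Then the (nonhomogeneous Lappo-Danilevskii) system $\dfrac{dx}{dt}=\sum_{j=1}^{m}\alpha_j(t)A_jx+f(t)$ has the first integrals $$F_\rho\colon(t,x)\mapsto\gamma_\rho(t,x)-\int_{t_0}^{t}\gamma_\rho(\eta,f(\eta))\,d\eta\quad\text{for all }(t,x)\in J\times\mathbb R^n,\quad\rho=1,2.$$
   Context: For a vector $\nu=(\nu_1,\dots,\nu_n)$ and $x\in\mathbb R^n$, $\nu x=\sum_{\xi=1}^n\nu_\xi x_\xi$; eigenvectors satisfy $B_j\nu=\lambda^{j}\nu$, $\nu\neq0$ regarded as a column. A first integral of $dx/dt=X(t,x)$ on a domain $G'$ (open arcwise connected set) is a continuously differentiable function $F\colon G'\to\mathbb R$ with $\partial_tF(t,x)+\sum_{\xi=1}^nX_\xi(t,x)\,\partial_{x_\xi}F(t,x)=0$ for all $(t,x)\in G'$. *)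

(* Defs.v *)
From HB Require Import structures.
From mathcomp Require Import all_boot all_order all_algebra.
From mathcomp Require Import all_classical all_reals all_analysis.
From mathcomp Require Export complex.
Set Implicit Arguments.
Unset Strict Implicit.
Unset Printing Implicit Defensive.
Import Order.TTheory GRing.Theory Num.Theory.
Import numFieldNormedType.Exports.
Local Open Scope classical_set_scope.
Local Open Scope ring_scope.

Definition dot (R : realType) (n : nat) (nu x : 'cV[R]_n) : R :=
  \sum_(xi < n) nu xi 0 * x xi 0.

(* The oriented integral, so that [t < t0] is allowed. *)
Definition oint (R : realType) (a b : R) (g : R -> R) : R :=
  if a <= b then Rintegral lebesgue_measure `[a, b] g
  else - Rintegral lebesgue_measure `[b, a] g.

Definition lin_indep_on (R : realType) (m : nat) (J : set R)
    (alpha : 'I_m -> R -> R) : Prop :=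
  forall c : 'I_m -> R,
    (forall t, J t -> \sum_(j < m) c j * alpha j t = 0) -> forall j, c j = 0.

(* Column eigenvectors; the library's [eigenvalue] and [eigenspace] are about
   row vectors. *)
Definition is_eigenvector (R : realType) (n : nat) (B : 'M[R]_n)
    (lambda : R[i]) (nu : 'cV[R[i]]_n) : Prop :=
  map_mx (real_complex R) B *m nu = lambda *: nu /\ nu != 0.

Definition Re_vec (R : realType) (n : nat) (nu : 'cV[R[i]]_n) : 'cV[R]_n :=
  map_mx (@complex.Re R) nu.

Definition Im_vec (R : realType) (n : nat) (nu : 'cV[R[i]]_n) : 'cV[R]_n :=
  map_mx (@complex.Im R) nu.

(* The derivative along [v] of a function defined on [G] only: the increment
   [h] is restricted to the values with [p + h *: v] in [G]. If [G] is open this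
   is the library's [is_derive] (see [has_deriv_alongE]); if [G] is
   [J `*` setT] and [J] contains an endpoint, it is one-sided in time there. *)
Definition has_deriv_along (R : realType) (n : nat) (G : set (R * 'cV[R]_n))
    (F : R * 'cV[R]_n -> R) (p v : R * 'cV[R]_n) (l : R) : Prop :=
  h^-1 * (F (p + h *: v) - F p)
    @[h --> within [set h : R | G (p + h *: v)] 0^'] --> l.

Lemma has_deriv_alongE (R : realType) (n : nat) (G : set (R * 'cV[R]_n))
    (F : R * 'cV[R]_n -> R) (p v : R * 'cV[R]_n) (l : R) :
  open G -> G p -> has_deriv_along G F p v l <-> is_derive p v F l.
Proof.
move=> oG Gp.
have cv : (fun h : R => p + h *: v) @ (0 : R) --> p.
  rewrite -[X in _ --> X]addr0 -(scale0r v).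
  by apply: cvgD; [exact: cvg_cst | apply: cvgZr_tmp; exact: cvg_id].
have nG : \forall h \near (0 : R)^', G (p + h *: v).
  by apply: nbhs_dnbhs; apply: (cv G); exact: open_nbhs_nbhs.
have wE : within [set h : R | G (p + h *: v)] 0^' = 0^'.
  apply/funext => B; apply/propext; split=> hB.
    have {}hB : \forall h \near (0 : R)^', G (p + h *: v) -> B h := hB.
    by near=> h; apply: (near hB h) => //; near: h.
  suff : \forall h \near (0 : R)^', G (p + h *: v) -> B h by [].
  by apply: filterS hB => h Bh _.
rewrite /has_deriv_along wE.
have -> : (fun h : R => h^-1 * (F (p + h *: v) - F p)) =
          (fun h : R => h^-1 *: ((F \o shift p) (h *: v) - F p)).
  by apply/funext => h /=; rewrite [p + _]addrC.
split=> [cF|[dF <-]]; last exact: dF.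
by split; [apply/cvg_ex; exists l | apply/cvg_lim].
Unshelve. all: by end_near.
Qed.

Definition e_time (R : realType) (n : nat) : R * 'cV[R]_n := (1, 0).

Definition e_space (R : realType) (n : nat) (xi : 'I_n) : R * 'cV[R]_n :=
  (0, delta_mx xi 0).

(* [F] is continuously differentiable on [G], with partial derivatives [Ft] and
   [Fx xi], and its derivative along the system [dx/dt = X(t, x)] vanishes. *)
Definition first_integral (R : realType) (n : nat)
    (X : R -> 'cV[R]_n -> 'cV[R]_n) (G : set (R * 'cV[R]_n))
    (F : R * 'cV[R]_n -> R) : Prop :=
  exists (Ft : R * 'cV[R]_n -> R) (Fx : 'I_n -> R * 'cV[R]_n -> R),
    [/\ {within G, continuous Ft},
        (forall xi, {within G, continuous (Fx xi)}),
        (forall p, G p -> has_deriv_along G F p (e_time R n) (Ft p)),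
        (forall p xi, G p -> has_deriv_along G F p (e_space R xi) (Fx xi p)) &
        forall t x, G (t, x) ->
          Ft (t, x) + \sum_(xi < n) X t x xi 0 * Fx xi (t, x) = 0].

Section lappo_danilevskii.
Variables (R : realType) (n m : nat).
Variables (alpha : 'I_m -> R -> R) (A : 'I_m -> 'M[R]_n) (f : R -> 'cV[R]_n).
Variables (lambda : 'I_m -> R[i]) (nu : 'cV[R[i]]_n) (t0 : R).

Definition LD_field (t : R) (x : 'cV[R]_n) : 'cV[R]_n :=
  \sum_(j < m) alpha j t *: (A j *m x) + f t.

Definition phase (t : R) : R :=
  oint t0 t (fun tau => \sum_(j < m) complex.Im (lambda j) * alpha j tau).

Definition growth (t : R) : R :=
  oint t0 t (fun tau => \sum_(j < m) complex.Re (lambda j) * alpha j tau).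

Definition gamma1 (t : R) (x : 'cV[R]_n) : R :=
  (dot (Re_vec nu) x * cos (phase t) + dot (Im_vec nu) x * sin (phase t))
  * expR (- growth t).

Definition gamma2 (t : R) (x : 'cV[R]_n) : R :=
  (dot (Im_vec nu) x * cos (phase t) - dot (Re_vec nu) x * sin (phase t))
  * expR (- growth t).

Definition LD_integral (gamma : R -> 'cV[R]_n -> R) (p : R * 'cV[R]_n) : R :=
  gamma p.1 p.2 - oint t0 p.1 (fun eta => gamma eta (f eta)).

End lappo_danilevskii.

(* Main.v *)
Require Import Defs.
From HB Require Import structures.
From mathcomp Require Import all_boot all_order all_algebra.
From mathcomp Require Import all_classical all_reals all_analysis.
From mathcomp Require Import complex.
From mathcomp Require Import ring lra.
Import Order.TTheory GRing.Theory Num.Theory.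
Import numFieldNormedType.Exports.
Local Open Scope classical_set_scope.
Local Open Scope ring_scope.

(* If [p] solves the adjoint system [dp/dt = - \sum_j alpha_j A_j^T p], then
   [dot (p t) x] is a first integral of the homogeneous system, and subtracting
   the integral of [dot (p t) (f t)] corrects for the forcing term. Multiplying
   a common eigenvector of the [A_j^T] by [exp (- \int \sum_j lambda_j alpha_j)]
   gives a complex solution of the adjoint system; its real and imaginary parts
   are the [p] of [gamma1] and [gamma2]. *)

(** * Oriented integrals of functions continuous on an interval *)

Lemma is_interval_itvcc (R : realType) (J : set R) (a b : R) :
  is_interval J -> J a -> J b -> `[a, b] `<=` J.
Proof. by move=> iJ Ja Jb c /=; rewrite in_itv/=; exact: iJ. Qed.

Lemma integrable_itvcc (R : realType) (J : set R) (g : R -> R) (a b : R) :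
  is_interval J -> {within J, continuous g} -> J a -> J b ->
  lebesgue_measure.-integrable `[a, b] (EFin \o g).
Proof.
move=> iJ cg Ja Jb; apply: continuous_compact_integrable.
  exact: segment_compact.
by apply: continuous_subspaceW cg; exact: is_interval_itvcc.
Qed.

Lemma Rintegral_itvcc_cat (R : realType) (J : set R) (g : R -> R) (a b c : R) :
  is_interval J -> {within J, continuous g} -> J a -> J c -> a <= b <= c ->
  Rintegral lebesgue_measure `[a, c] g =
  Rintegral lebesgue_measure `[a, b] g + Rintegral lebesgue_measure `[b, c] g.
Proof.
move=> iJ cg Ja Jc /andP[ab bc].
have Jb : J b by apply: (iJ a c) => //; rewrite ab.
(* Opening the left end of [[b, c]] leaves the integral unchanged and makes the two pieces
   disjoint. *)
rewrite -(@Rintegral_itv_obnd_cbnd _ b); last first.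
  move: (integrable_itvcc _ J g b c iJ cg Jb Jc); apply: integrableS => //.
  exact: subset_itv_oc_cc.
by rewrite -(@Rintegral_itvB _ _ (BLeft a) (BRight c)) ?bnd_simp//;
  [rewrite addrC subrK | exact: integrable_itvcc cg _ _].
Qed.

Lemma oint_cat (R : realType) (J : set R) (g : R -> R) (a b c : R) :
  is_interval J -> {within J, continuous g} -> J a -> J b -> J c ->
  oint a c g = oint a b g + oint b c g.
Proof.
move=> iJ cg Ja Jb Jc; rewrite /oint.
have C := @Rintegral_itvcc_cat _ J g _ _ _ iJ cg.
have Z x : Rintegral lebesgue_measure `[x, x] g = 0.
  by rewrite set_itv1 Rintegral_set1.
(* Of the eight sign patterns, the two cyclic ones are contradictory; each of the others is
   additivity over the sorted triple, up to signs. *)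
have [ab|ba] := leP a b; have [bc|cb] := leP b c; have [ac|ca] := leP a c => //.
- by apply: C => //; rewrite ab.
- lra.
- by rewrite (C a c b) ?ac ?(ltW cb)// addrK.
- by rewrite (C c a b) ?ab ?(ltW ca)//; lra.
- by rewrite (C b a c) ?ac ?(ltW ba)//; lra.
- by rewrite (C b c a) ?bc ?(ltW ca)//; lra.
- lra.
- by rewrite (C c b a) ?(ltW ba) ?(ltW cb)//; lra.
Qed.

(** The estimate behind the fundamental theorem of calculus, used with [k] the value of [g] at the
    endpoint [a]. For [a <= b] the left-hand side is the norm of the integral of [g - k]; the case
    [b <= a] follows by exchanging the endpoints. *)
Lemma oint_near_cst (R : realType) (J : set R) (g : R -> R) (a b k e : R) :
  is_interval J -> {within J, continuous g} -> J a -> J b ->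
  (forall x, x \in `[Num.min a b, Num.max a b] -> `|g x - k| <= e) ->
  `|oint a b g - (b - a) * k| <= e * `|b - a|.
Proof.
move=> iJ cg.
wlog ab : a b / a <= b => [hw|] Ja Jb ge.
  have [ab|/ltW ba] := leP a b; first exact: hw.
  have := hw _ _ ba Jb Ja; rewrite minC maxC => /(_ ge).
  rewrite (distrC a b); congr (_ <= _); rewrite -[LHS]normrN; congr `|_|.
  rewrite (_ : oint b a g = - oint a b g); first by lra.
  by have := @oint_cat _ J g a b a iJ cg Ja Jb Ja;
    rewrite {1}/oint lexx set_itv1 Rintegral_set1; lra.
move: ge; rewrite min_l// max_r// => ge.
have muab : fine (@lebesgue_measure R `[a, b]%classic) = b - a.
  by rewrite lebesgue_measure_itv/= lte_fin; case: ltgtP ab => // -> _; rewrite subrr.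
have ig := @integrable_itvcc _ J g a b iJ cg Ja Jb.
have icst r : lebesgue_measure.-integrable `[a, b] (EFin \o (fun=> r : R)).
  by apply: (@integrable_itvcc _ J) => //; exact: cst_continuous.
have igk : lebesgue_measure.-integrable `[a, b] (EFin \o (fun x => g x - k)).
  apply: (@integrable_itvcc _ J) => //.
  by apply: within_continuousB => //; exact: cst_continuous.
have -> : oint a b g - (b - a) * k =
    Rintegral lebesgue_measure `[a, b] (fun x => g x - k).
  by rewrite /oint ab RintegralB// Rintegral_cst// muab mulrC.
apply: le_trans (le_normr_Rintegral _ _) _ => //.
rewrite [X in _ <= _ * X]ger0_norm ?subr_ge0// -muab -Rintegral_cst//.
by apply: le_Rintegral => //; exact: integrable_norm.
Qed.

(** * Calculus of derivatives relative to a set *)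

(* Carathéodory's form of the derivative at [t] relative to [J]: the sum,
   product and chain rules become identities between the slope functions [q]. *)
Definition deriv_within {R : realType} (J : set R) (u : R -> R) (t l : R) :=
  exists2 q : R -> R, (forall s, J s -> u s - u t = q s * (s - t)) &
    q @ within J (nbhs t) --> l.

Section deriv_within.
Context {R : realType} {J : set R}.
Implicit Types (u v : R -> R) (t k l : R).

Lemma cvg_within_id t : s @[s --> within J (nbhs t)] --> t.
Proof. exact: cvg_within. Qed.

Lemma deriv_within_cvg {u t l} :
  deriv_within J u t l -> u @ within J (nbhs t) --> u t.
Proof.
move=> [q uq ql].
have : u t + q s * (s - t) @[s --> within J (nbhs t)] --> u t + l * (t - t).
  apply: cvgD; first exact: cvg_cst.
  by apply: cvgM => //; apply: cvgB; [exact: cvg_within_id | exact: cvg_cst].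
rewrite subrr mulr0 addr0; apply: cvg_trans; apply: near_eq_cvg.
have := near_withinT J (nbhs_filter t); apply: filterS => s Js.
by rewrite -uq// addrC subrK.
Qed.

Lemma deriv_within_cst k t : deriv_within J (cst k) t 0.
Proof.
by exists (cst 0) => [s _|]; [rewrite subrr mul0r | exact: cvg_cst].
Qed.

Lemma deriv_withinD {u v t k l} : deriv_within J u t k -> deriv_within J v t l ->
  deriv_within J (fun s => u s + v s) t (k + l).
Proof.
move=> [q uq qk] [r vr rl]; exists (fun s => q s + r s); last exact: cvgD.
by move=> s Js; rewrite mulrDl -uq// -vr//; ring.
Qed.

Lemma deriv_withinM {u v t k l} : deriv_within J u t k -> deriv_within J v t l ->
  deriv_within J (fun s => u s * v s) t (k * v t + u t * l).
Proof.
move=> [q uq qk] dv; have cv := deriv_within_cvg dv.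
case: dv => r vr rl; exists (fun s => q s * v s + u t * r s).
  by move=> s Js; rewrite mulrDl mulrAC -uq// -[u t * r s * _]mulrA -vr//; ring.
by apply: cvgD; apply: cvgM => //; exact: cvg_cst.
Qed.

Lemma deriv_withinN {u t l} :
  deriv_within J u t l -> deriv_within J (fun s => - u s) t (- l).
Proof.
move=> [q uq ql]; exists (fun s => - q s); last exact: cvgN.
by move=> s Js; rewrite mulNr -uq// opprB opprK addrC.
Qed.

Lemma deriv_within_sum (I : Type) (r : seq I) (u : I -> R -> R) (l : I -> R) t :
  (forall i, deriv_within J (u i) t (l i)) ->
  deriv_within J (fun s => \sum_(i <- r) u i s) t (\sum_(i <- r) l i).
Proof.
move=> du; elim: r => [|i r IH].
  rewrite big_nil (_ : (fun _ => _) = cst 0); first exact: deriv_within_cst.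
  by apply/funext => s; rewrite big_nil.
rewrite big_cons (_ : (fun _ => _) = fun s => u i s + \sum_(j <- r) u j s).
  exact: deriv_withinD.
by apply/funext => s; rewrite big_cons.
Qed.

(** The outer function is differentiable in the ordinary sense, which suffices for [cos], [sin] and
    [expR]; only the inner one is restricted to [J]. The slope function of the composite is the
    product of the two slope functions. *)
Lemma deriv_within_comp {g : R -> R} {u t k l} :
  is_derive (u t) 1 g k -> deriv_within J u t l ->
  deriv_within J (g \o u) t (k * l).
Proof.
move=> /is_derive1_caratheodory[r [gr cr <-]] du.
have cu := deriv_within_cvg du.
case: du => q uq ql; exists (fun s => r (u s) * q s).
  by move=> s Js; rewrite /= gr uq// mulrA.
by apply: cvgM => //; exact: (cvg_comp _ _ cu).
Qed.

(** The fundamental theorem of calculus relative to [J]: it covers both sides of [t], and is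
    one-sided if [t] is an endpoint of [J]. *)
Lemma deriv_within_oint (g : R -> R) (t0 t : R) :
  is_interval J -> {within J, continuous g} -> J t0 -> J t ->
  deriv_within J (fun s => oint t0 s g) t (g t).
Proof.
move=> iJ cg Jt0 Jt.
(* The filter [within J (nbhs t)] does not exclude [t] itself, so the slope must take its limit
   value [g t] there. *)
exists (fun s => if s == t then g t else oint t s g / (s - t)).
  move=> s Js; case: eqVneq => [->|st]; first by rewrite !subrr mulr0.
  by rewrite (@oint_cat _ J g t0 t s)// addrC addKr divfK// subr_eq0.
apply/cvgrPdist_le => e e0.
have /subspace_continuousP/(_ t Jt)/cvgrPdist_le/(_ e e0) := cg.
rewrite !near_withinE => /nbhs_ballP[d /= d0 dg].
apply/nbhs_ballP; exists d => // s ts Js.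
case: eqVneq => [_|st]; first by rewrite subrr normr0 ltW.
have st0 : s - t != 0 by rewrite subr_eq0.
rewrite distrC -(ler_pM2r (_ : 0 < `|s - t|)) ?normr_gt0// -normrM mulrBl divfK//.
rewrite [g t * _]mulrC; apply: (@oint_near_cst _ J) => // x.
(* A point between [t] and [s] lies in [J] and is no farther from [t] than [s] is. *)
rewrite in_itv/= => xts; rewrite distrC; apply: dg; last first.
  by move: xts; case: (leP t s) => _; [exact: iJ|exact: iJ].
move: ts; rewrite /ball/= => ts; apply: le_lt_trans ts.
have := ler_norm (t - s); have := ler_norm (s - t); rewrite [`|s - t|]distrC.
by rewrite ler_norml; move: xts; case: (leP t s) => _ /andP[? ?]; lra.
Qed.

End deriv_within.

(** * Partial derivatives in time and space *)

Lemma cvg_to_within (T U : Type) (F : set_system T) (FF : Filter F)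
    (G : set_system U) (D : set U) (f : T -> U) :
  f @ F --> G -> (\forall x \near F, D (f x)) -> f @ F --> within D G.
Proof.
move=> fG FD P /fG /= GP; rewrite nbhs_simpl/=.
by apply: filterS2 FD GP => x Dfx; exact.
Qed.

(** For a nonzero admissible increment [h], the difference quotient is the slope function [q] at
    [t + h], and [t + h] tends to [t] inside [J]. *)
Lemma has_deriv_along_time (R : realType) (n : nat) (J : set R)
    (F : R * 'cV[R]_n -> R) (t : R) (x : 'cV[R]_n) (l : R) :
  deriv_within J (fun s => F (s, x)) t l ->
  has_deriv_along (J `*` setT) F (t, x) (e_time R n) l.
Proof.
move=> [q Fq ql]; rewrite /has_deriv_along.
have EG h : (t, x) + h *: e_time R n = (t + h, x).
  rewrite /e_time; congr pair; rewrite /= ?scaler0 ?addr0//; congr (_ + _).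
  by rewrite /GRing.scale/= mulr1.
have th : (t + h) @[h -->
    within [set h : R | (J `*` setT) ((t, x) + h *: e_time R n)] 0^']
    --> within J (nbhs t).
  apply: cvg_to_within.
    apply: cvg_within_filter; apply: cvg_within_filter.
    have : t + h @[h --> 0] --> t + 0.
      by apply: cvgD; [exact: cvg_cst | exact: cvg_id].
    by rewrite addr0.
  by rewrite near_withinE; apply: nearW => h; rewrite /mkset EG => -[].
apply: cvg_trans (cvg_comp _ _ th ql); apply: near_eq_cvg.
rewrite near_withinE; apply: filterS (@nbhs_dnbhs_neq R 0) => h h0.
rewrite /mkset EG => -[/= Jh _].
by rewrite Fq// [t + h]addrC addrK mulrC mulfK.
Qed.

(** Affine dependence on [h] makes the difference quotient constantly [l], whatever [G] is. *)
Lemma has_deriv_along_space (R : realType) (n : nat) (G : set (R * 'cV[R]_n))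
    (F : R * 'cV[R]_n -> R) (t : R) (x : 'cV[R]_n) (xi : 'I_n) (l : R) :
  (forall h, F (t, x + h *: delta_mx xi 0) = F (t, x) + h * l) ->
  has_deriv_along G F (t, x) (e_space R xi) l.
Proof.
move=> Fl; rewrite /has_deriv_along.
apply: cvg_within_filter.
apply: (@cvg_trans _ (cst l @ 0^')); last exact: cvg_cst.
apply: near_eq_cvg; near=> h.
have -> : (t, x) + h *: e_space R xi = (t, x + h *: delta_mx xi 0).
  by rewrite /e_space; congr pair; rewrite /= scaler0 addr0.
rewrite Fl [_ + h * l]addrC addrK mulKf//.
by near: h; exact: nbhs_dnbhs_neq.
Unshelve. all: by end_near. Qed.

(** * Bilinearity and continuity of the pairing [dot] *)

Section dot.
Variables (R : realType) (n : nat).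
Implicit Types (p x : 'cV[R]_n).

Lemma dotE p x : dot p x = (p^T *m x) 0 0.
Proof. by rewrite mxE; apply: eq_bigr => i _; rewrite mxE. Qed.

Lemma dotDl p q x : dot (p + q) x = dot p x + dot q x.
Proof. by rewrite !dotE linearD/= mulmxDl mxE. Qed.

Lemma dotZl k p x : dot (k *: p) x = k * dot p x.
Proof. by rewrite !dotE linearZ/= -scalemxAl mxE. Qed.

Lemma dotDr p x y : dot p (x + y) = dot p x + dot p y.
Proof. by rewrite !dotE mulmxDr mxE. Qed.

Lemma dotZr k p x : dot p (k *: x) = k * dot p x.
Proof. by rewrite !dotE -scalemxAr mxE. Qed.

Lemma dot_delta p i : dot p (delta_mx i 0) = p i 0.
Proof. by rewrite dotE -colE !mxE. Qed.

Lemma dot_trmx (A : 'M[R]_n) p x : dot (A^T *m p) x = dot p (A *m x).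
Proof. by rewrite !dotE trmx_mul trmxK mulmxA. Qed.

Lemma dot_suml m (p : 'I_m -> 'cV[R]_n) x :
  dot (\sum_(j < m) p j) x = \sum_(j < m) dot (p j) x.
Proof.
by rewrite dotE linear_sum/= mulmx_suml summxE; apply: eq_bigr => j _; rewrite dotE.
Qed.

Lemma dot_sumr m p (x : 'I_m -> 'cV[R]_n) :
  dot p (\sum_(j < m) x j) = \sum_(j < m) dot p (x j).
Proof.
by rewrite dotE mulmx_sumr summxE; apply: eq_bigr => j _; rewrite dotE.
Qed.

Lemma cvg_dot (T : Type) (F : set_system T) (FF : Filter F)
    (p x : T -> 'cV[R]_n) (a b : 'cV[R]_n) :
  (forall i, p s i 0 @[s --> F] --> a i 0) ->
  (forall i, x s i 0 @[s --> F] --> b i 0) ->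
  dot (p s) (x s) @[s --> F] --> dot a b.
Proof.
move=> pa xb; apply: (cvg_big (op := +%R)) => [|i _]; first exact: add_continuous.
exact: cvgM.
Qed.

End dot.

(** * First integrals from solutions of the adjoint system *)

Lemma adjoint_first_integral (R : realType) (n m : nat) (J : set R)
    (alpha : 'I_m -> R -> R) (A : 'I_m -> 'M[R]_n) (f : R -> 'cV[R]_n)
    (t0 : R) (p : R -> 'cV[R]_n) :
  is_interval J -> (forall j, {within J, continuous (alpha j)}) ->
  {within J, continuous f} -> J t0 ->
  (forall t i, J t -> deriv_within J (fun s => p s i 0) t
     ((- \sum_(j < m) alpha j t *: ((A j)^T *m p t)) i 0)) ->
  first_integral (LD_field alpha A f) (J `*` setT)
    (LD_integral f t0 (fun t x => dot (p t) x)).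
Proof.
move=> iJ calpha cf Jt0 dp.
have cp t i : J t -> p s i 0 @[s --> within J (nbhs t)] --> p t i 0.
  by move=> Jt; exact: deriv_within_cvg (dp t i Jt).
have cfi t i : J t -> f s i 0 @[s --> within J (nbhs t)] --> f t i 0.
  move=> Jt; have /subspace_continuousP/(_ t Jt) := cf.
  have := @coord_continuous _ _ _ i 0 (f t).
  by move=> ci cft; exact: (cvg_comp f (fun M : 'cV[R]_n => M i 0) cft ci).
have calp t j : J t -> alpha j s @[s --> within J (nbhs t)] --> alpha j t.
  by move=> Jt; have /subspace_continuousP/(_ t Jt) := calpha j.
have cfst (t : R) (x : 'cV[R]_n) :
    P.1 @[P --> within (J `*` setT) (nbhs (t, x))] --> within J (nbhs t).
  apply: cvg_to_within.
    by apply: cvg_within_filter; exact: cvg_fst.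
  by rewrite near_withinE; apply: nearW => P -[].
have csnd (t : R) (x : 'cV[R]_n) i :
    (fun P : R * 'cV[R]_n => P.2 i 0) @ within (J `*` setT) (nbhs (t, x)) --> x i 0.
  apply: cvg_within_filter; apply: (cvg_comp snd (fun M : 'cV[R]_n => M i 0)).
    exact: cvg_snd.
  exact: coord_continuous.
(* The function is affine in [x] with gradient [p t]; the time derivative is then forced by the
   first-integral equation. *)
exists (fun P => - dot (p P.1) (LD_field alpha A f P.1 P.2)), (fun i P => p P.1 i 0).
split.
- apply/subspace_continuousP => -[t x] [/= Jt _].
  apply: cvgN; apply: cvg_dot => i.
    exact: (cvg_comp _ _ (cfst t x) (cp t i Jt)).
  (* Writing [A j *m y] through the rows of [A j] reduces its continuity to [cvg_dot]. *)
  have LDE s y : LD_field alpha A f s y i 0 =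
      \sum_(j < m) alpha j s * dot (row i (A j))^T y + f s i 0.
    rewrite /LD_field mxE summxE; congr (_ + _); apply: eq_bigr => j _.
    by rewrite !mxE; congr (_ * _); apply: eq_bigr => k _; rewrite !mxE.
  under eq_fun do rewrite LDE.
  rewrite LDE; apply: cvgD; last exact: (cvg_comp _ _ (cfst t x) (cfi t i Jt)).
  apply: (cvg_big (op := +%R)) => [|j _]; first exact: add_continuous.
  apply: cvgM; first exact: (cvg_comp _ _ (cfst t x) (calp t j Jt)).
  by apply: cvg_dot => k //; exact: cvg_cst.
- move=> i; apply/subspace_continuousP => -[t x] [/= Jt _].
  exact: (cvg_comp _ _ (cfst t x) (cp t i Jt)).
- move=> -[t x] [/= Jt _]; apply: has_deriv_along_time.
  have dg : deriv_within J (fun s => oint t0 s (fun eta => dot (p eta) (f eta))) t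
      (dot (p t) (f t)).
    apply: deriv_within_oint => //; apply/subspace_continuousP => s Js.
    by apply: cvg_dot => i; [exact: cp | exact: cfi].
  have dpx : deriv_within J (fun s => dot (p s) x) t
      (dot (- \sum_(j < m) alpha j t *: ((A j)^T *m p t)) x).
    apply: deriv_within_sum => i.
    have := deriv_withinM (dp t i Jt) (deriv_within_cst (x i 0) t).
    by rewrite mulr0 addr0.
  have := deriv_withinD dpx (deriv_withinN dg).
  congr (deriv_within _ _ _ _).
  (* Transposition moves each [(A j)^T] from [p t] onto [x], so the adjoint term becomes the
     homogeneous part of the field; the integral supplies the forcing part. *)
  rewrite -scaleN1r dotZl mulN1r dotDr opprD; congr (- _ - _).
  rewrite dot_suml dot_sumr; apply: eq_bigr => j _.
  by rewrite dotZl dotZr dot_trmx.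
- move=> -[t x] i _; apply: has_deriv_along_space => h.
  by rewrite /LD_integral/= dotDr dotZr dot_delta addrAC.
- move=> t x _; rewrite addrC; apply/eqP; rewrite subr_eq0; apply/eqP.
  by apply: eq_bigr => i _; rewrite mulrC.
Qed.

(** * Complex eigenvectors in real form, and the two first integrals *)

(** A real matrix commutes with taking real and imaginary parts, so both parts of the eigenvector
    equation can be compared. *)
Lemma eigenvector_Re_Im (R : realType) (n : nat) (B : 'M[R]_n) (l : R[i])
    (nu : 'cV[R[i]]_n) : is_eigenvector B l nu ->
  B *m Re_vec nu = complex.Re l *: Re_vec nu - complex.Im l *: Im_vec nu /\
  B *m Im_vec nu = complex.Re l *: Im_vec nu + complex.Im l *: Re_vec nu.
Proof.
move=> [+ _] => Bnu.
have BRe i : complex.Re ((map_mx (real_complex R) B *m nu) i 0) = (B *m Re_vec nu) i 0.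
  rewrite !mxE raddf_sum; apply: eq_bigr => j _; rewrite !mxE /=.
  by case: (nu j 0) => a b /=; rewrite mul0r subr0.
have BIm i : complex.Im ((map_mx (real_complex R) B *m nu) i 0) = (B *m Im_vec nu) i 0.
  rewrite !mxE raddf_sum; apply: eq_bigr => j _; rewrite !mxE /=.
  by case: (nu j 0) => a b /=; rewrite mul0r addr0.
split; apply/matrixP => i j; rewrite (ord1 j) -?BRe -?BIm Bnu !mxE;
  by case: l Bnu (nu i 0) => a b _ [c d] /=.
Qed.

Lemma within_continuous_lin_comb (R : realType) (m : nat) (J : set R)
    (c : 'I_m -> R) (alpha : 'I_m -> R -> R) :
  (forall j, {within J, continuous (alpha j)}) ->
  {within J, continuous (fun t => \sum_(j < m) c j * alpha j t)}.
Proof.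
move=> calpha; apply/subspace_continuousP => t Jt.
apply: (cvg_big (op := +%R)) => [|j _]; first exact: add_continuous.
by apply: cvgM; [exact: cvg_cst | have /subspace_continuousP/(_ t Jt) := calpha j].
Qed.

(** The last two hypotheses are the real form of the eigenvector equation for [a + i b]. Leaving the
    pair [(a, b)] free lets one computation serve both [gamma1] and [gamma2]. *)
Lemma rotating_first_integral (R : realType) (n m : nat) (J : set R)
    (alpha : 'I_m -> R -> R) (A : 'I_m -> 'M[R]_n) (f : R -> 'cV[R]_n)
    (lambda : 'I_m -> R[i]) (t0 : R) (a b : 'cV[R]_n) :
  is_interval J -> (forall j, {within J, continuous (alpha j)}) ->
  {within J, continuous f} -> J t0 ->
  (forall j, (A j)^T *m a = complex.Re (lambda j) *: a - complex.Im (lambda j) *: b) ->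
  (forall j, (A j)^T *m b = complex.Re (lambda j) *: b + complex.Im (lambda j) *: a) ->
  first_integral (LD_field alpha A f) (J `*` setT)
    (LD_integral f t0 (fun t x =>
       (dot a x * cos (phase alpha lambda t0 t) + dot b x * sin (phase alpha lambda t0 t))
       * expR (- growth alpha lambda t0 t))).
Proof.
move=> iJ calpha cf Jt0 Aa Ab.
pose th := phase alpha lambda t0; pose g := growth alpha lambda t0.
(* This is the real part of [z = exp (- g - i th) (a + i b)]. *)
pose p t := expR (- g t) *: (cos (th t) *: a + sin (th t) *: b).
rewrite (_ : (fun t x => _) = fun t x => dot (p t) x); last first.
  by apply/funext => t; apply/funext => x; rewrite dotZl dotDl !dotZl; ring.
apply: adjoint_first_integral => // t i Jt.
have dint c := deriv_within_oint _ _ _ iJ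
  (within_continuous_lin_comb _ _ _ c _ calpha) Jt0 Jt.
have dth : deriv_within J th t _ := dint (fun j => complex.Im (lambda j)).
have dg : deriv_within J g t _ := dint (fun j => complex.Re (lambda j)).
have dcos := deriv_within_comp (is_derive_cos (th t)) dth.
have dsin := deriv_within_comp (is_derive_sin (th t)) dth.
have dexp := deriv_within_comp (u := fun s => - g s) (is_derive_expR _)
  (deriv_withinN dg).
have := deriv_withinM dexp (deriv_withinD
  (deriv_withinM dcos (deriv_within_cst (a i 0) t))
  (deriv_withinM dsin (deriv_within_cst (b i 0) t))).
rewrite (_ : (fun s => p s i 0) = fun s => (expR \o (fun s => - g s)) s *
    ((cos \o th) s * cst (a i 0) s + (sin \o th) s * cst (b i 0) s)); last first.
  by apply/funext => s; rewrite !mxE.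
congr (deriv_within _ _ _ _).
(* Each [(A j)^T] sends [p = Re z] to [Re lambda_j Re z - Im lambda_j Im z]; the last factor is a
   coordinate of [- Im z]. Summed over [j], the coefficients become the derivatives of [g] and [th],
   as in the product rule. *)
have -> : (- \sum_(j < m) alpha j t *: ((A j)^T *m p t)) i 0 =
  - \sum_(j < m) (complex.Re (lambda j) * alpha j t * p t i 0 +
    complex.Im (lambda j) * alpha j t *
      (expR (- g t) * (sin (th t) * a i 0 - cos (th t) * b i 0))).
  rewrite mxE summxE; congr (- _); apply: eq_bigr => j _.
  by rewrite -scalemxAr mulmxDr -!scalemxAr Aa Ab !mxE; ring.
by rewrite big_split/= -!mulr_suml !mxE/=; ring.
Qed.

Theorem theorem2p13 (R : realType) (n m : nat) (J : set R)
    (alpha : 'I_m -> R -> R) (A : 'I_m -> 'M[R]_n) (f : R -> 'cV[R]_n)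
    (lambda : 'I_m -> R[i]) (nu : 'cV[R[i]]_n) (t0 : R)
    (J_itv : is_interval J)
    (alpha_cont : forall j, {within J, continuous (alpha j)})
    (alpha_indep : lin_indep_on J alpha)
    (A_comm : forall j k, A j *m A k = A k *m A j)
    (f_cont : {within J, continuous f})
    (nu_eigen : forall j, is_eigenvector (A j)^T (lambda j) nu)
    (Im_nu_neq0 : Im_vec nu != 0)
    (J_t0 : J t0) :
  first_integral (LD_field alpha A f) (J `*` [set: 'cV[R]_n])
    (LD_integral f t0 (gamma1 alpha lambda nu t0)) /\
  first_integral (LD_field alpha A f) (J `*` [set: 'cV[R]_n])
    (LD_integral f t0 (gamma2 alpha lambda nu t0)).
Proof.
pose a := Re_vec nu; pose b := Im_vec nu.
have Aa j := (eigenvector_Re_Im _ _ _ _ _ (nu_eigen j)).1.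
have Ab j := (eigenvector_Re_Im _ _ _ _ _ (nu_eigen j)).2.
split; first exact: (rotating_first_integral _ _ _ _ _ _ _ _ _ a b).
(* Multiplying [nu] by [- 'i] replaces its real and imaginary parts [(a, b)]
   by [(b, - a)], and [gamma1] by [gamma2]. *)
have := rotating_first_integral _ _ _ J alpha A f lambda t0 b (- a) J_itv
  alpha_cont f_cont J_t0.
rewrite (_ : (fun t x => _) = gamma2 alpha lambda nu t0); last first.
  by apply/funext => t; apply/funext => x; rewrite /gamma2 -scaleN1r dotZl mulN1r mulNr.
apply=> j; first by rewrite scalerN opprK Ab.
by rewrite mulmxN Aa opprB scalerN addrC.
Qed.
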